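(* An optimal solution of the reduced problem (defined in the context), together with the prices recovered via $$\pi_{od}^*=\mathrm{VOT}\,(t_{od}^{pt*}-t_{od}^{a*})+P^{pt}-\log\frac{x_{od}^{a*}}{x_{od}^{pt*}},\qquad \forall (o,d)\in\tilde D,$$ yields an optimal solution of the original problem (defined in the context). Here $x_{od}^{a*},x_{od}^{pt*}$ are the values in the optimal solution of the reduced problem, and $t_{od}^{a*}$, $t_{od}^{pt*}$ are the travel times computed from (T1) and (T2), respectively, at that solution.
   Context: Setting: a multimodal network served by an autonomous mobility-on-demand operator (mode $a$) and a public transit operator (mode $pt$). Data. $(\mathcal V^a,\mathcal E^a)$ is a strongly connected directed road graph; $\mathcal E^{pt}$ is the set of transit edges; $L$ is the set of transit lines; $S$ is a finite set of admissible service frequencies; $\tilde D$ is the set of origin-destination (OD) pairs, which are ordered pairs of distinct nodes of a walking network that shares nodes with the road and transit networks, with demands $\alpha_{od}>0$; for each $(o,d)\in\tilde D$, $P_a^{od}$ is a set of candidate road paths; $\delta_{ij}^p\in\{0,1\}$ indicates whether road edge $(i,j)$ lies on path $p$; $\eta_e^{od}\in\{0,1\}$ indicates whether transit edge $e$ lies on the fixed transit reference path of $(o,d)$; $\mu_e^l\in\{0,1\}$ indicates whether $e$ belongs to line $l$; $\gamma_{odl}\in\{0,1\}$ indicates whether the reference path of $(o,d)$ includes boarding or transfer to line $l$. Constants: $C_l$ (unit vehicle capacity of line $l$), $K_l$ and $C_{ij}$ (transit and road operating cost coefficients), $b_{ij}$ (exogenous background traffic), $\tau_{od}^{pt}$ (fixed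 travel time along the transit reference path), $P^{pt}$ (fixed transit fare), $\mathrm{VOT}>0$ (value of time), $\mathrm{VOT}_{\mathrm{ENV}}$ (weight of road delay in the social cost). The road travel time on edge $(i,j)$ is the nondecreasing BPR function $T(q)=t_{ij}^0\big[1+\alpha_B (q/c_{ij})^{\beta}\big]$, where $t_{ij}^0$ and $c_{ij}$ are the free-flow travel time and capacity of the edge and $\alpha_B,\beta$ are the BPR parameters. For a road node $v$, $e^-(v)$ and $e^+(v)$ are the sets of incoming and outgoing road edges. Variables: path flows $x_{od,p}^a$, mode demands $x_{od}^a$ and $x_{od}^{pt}$, total vehicle flows $f_{ij}$, rebalancing flows $r_{ij}$, prices $\pi_{od}$, line frequencies $s_l$, frequency selectors $z_{ls}\in\{0,1\}$. Constraints: (F) $f_{ij}=r_{ij}+\sum_{(o,d)\in\tilde D}\sum_{p\in P_a^{od}}x_{od,p}^a\delta_{ij}^p$ for all $(i,j)\in\mathcal E^a$. (C) $\sum_{(i,v)\in e^-(v)}r_{iv}-\sum_{(v,j)\in e^+(v)}r_{vj}=\sum_{(v,d)\in\tilde D}\sum_{p\in P_a^{vd}}x_{vd,p}^a-\sum_{(o,v)\in\tilde D}\sum_{p\in P_a^{ov}}x_{ov,p}^a$ for all $v\in\mathcal V^a$. (K) $\sum_{(o,d)\in\tilde D}\eta_e^{od}x_{od}^{pt}\le\sum_{l\in L}C_l\mu_e^l s_l$ for all $e\in\mathcal E^{pt}$. (D) $x_{od}^a=\sum_{p\in P_a^{od}}x_{od,p}^a$ and $x_{od}^{pt}=\alpha_{od}-x_{od}^a$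 for all $(o,d)\in\tilde D$. (T1) $t_{od}^a=\sum_{p\in P_a^{od}}\frac{x_{od,p}^a}{x_{od}^a}\sum_{(i,j)\in\mathcal E^a}T(b_{ij}+f_{ij})\delta_{ij}^p$ for all $(o,d)\in\tilde D$. (T2) $t_{od}^{pt}=\tau_{od}^{pt}+\frac12\sum_{l\in L}\gamma_{odl}/s_l$ for all $(o,d)\in\tilde D$. (V) $V_{od}^a=-\mathrm{VOT}\cdot t_{od}^a-\pi_{od}$ and $V_{od}^{pt}=-\mathrm{VOT}\cdot t_{od}^{pt}-P^{pt}$ for all $(o,d)\in\tilde D$. (S) $\sum_{s\in S}z_{ls}=1$, $s_l=\sum_{s\in S}s\,z_{ls}$, $z_{ls}\in\{0,1\}$, for all $l\in L$. (L) $x_{od}^a=\alpha_{od}\,e^{V_{od}^a}/(e^{V_{od}^a}+e^{V_{od}^{pt}})$ for all $(o,d)\in\tilde D$. (N) $x_{od,p}^a,\ x_{od}^{pt},\ r_{ij}\ge 0$. Objective (social cost): $\mathrm{VOT}_{\mathrm{ENV}}\sum_{(i,j)\in\mathcal E^a}(b_{ij}+f_{ij})T(b_{ij}+f_{ij})+\mathrm{VOT}\sum_{(o,d)\in\tilde D}x_{od}^{pt}t_{od}^{pt}+\sum_{(i,j)\in\mathcal E^a}C_{ij}f_{ij}+\sum_{l\in L}K_ls_l$. Original problem: minimize the objective over $(\boldsymbol{x}^a,\boldsymbol{x}^{pt},\boldsymbol{f},\boldsymbol{r},\boldsymbol{\pi},\boldsymbol{s},\boldsymbol{z})$ subject to (F),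 (C), (K), (D), (T1), (T2), (V), (S), (L), (N). Reduced problem: remove the price variables and the logit choice constraint, and minimize the same objective over the remaining flow and service-design variables subject to (F), (C), (K), (D), (T2), (S), (N).
   Formalization: It is assumed that both mode demands are strictly positive for every OD pair at the reduced optimum; otherwise the recovered price (and the road travel time, if the road demand is zero) is undefined and the logit constraint cannot hold. *)

(* Defs.v *)
From mathcomp Require Import all_boot all_order all_algebra.
From mathcomp Require Import finmap.
From mathcomp Require Import all_classical all_reals all_analysis.

Set Implicit Arguments.
Unset Strict Implicit.
Unset Printing Implicit Defensive.

Import Order.TTheory GRing.Theory Num.Theory.
Local Open Scope ring_scope.

Definition bpr (R : realType) (t0 c aB beta q : R) : R :=
  t0 * (1 + aB * (q / c) `^ beta).

(* [N] is a common universe of nodes: the road and walking networks are given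
   by subsets of [N], and may therefore share nodes.  Families indexed by road
   edges or OD pairs are functions on all of [N * N]; only their values on
   [road_edges] or [od_pairs] are ever used. *)
Record network (R : realType) (N TE L : finType) := Network {
  road_nodes : {set N};
  road_edges : {set N * N};
  walk_nodes : {set N};
  od_pairs : {set N * N};
  frequencies : {fset R};
  demand : N * N -> R;
  road_paths : N * N -> {fset seq N};      (* paths as sequences of nodes *)
  eta : N * N -> TE -> bool;
  mu : L -> TE -> bool;
  gamma : N * N -> L -> bool;
  line_capacity : L -> R;
  line_cost : L -> R;
  road_cost : N * N -> R;
  background : N * N -> R;
  tau : N * N -> R;
  fare : R;
  VOT : R;
  VOT_ENV : R;
  free_flow_time : N * N -> R;
  road_capacity : N * N -> R;
  bpr_alpha : R;
  bpr_beta : R;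
  road_edgesP : forall e, e \in road_edges ->
    e.1 \in road_nodes /\ e.2 \in road_nodes;
  road_strongly_connected :
    {in road_nodes &, forall u v,
       connect [rel i j | (i, j) \in road_edges] u v};
  od_pairsP : forall od, od \in od_pairs ->
    [/\ od.1 \in walk_nodes, od.2 \in walk_nodes & od.1 != od.2];
  demand_gt0 : forall od, od \in od_pairs -> 0 < demand od;
  road_pathsP : forall od p, od \in od_pairs -> p \in road_paths od ->
    [/\ p != [::],
        {subset p <= road_nodes} &
        sorted [rel i j | (i, j) \in road_edges] p];
  (* The endpoints of an OD pair are walking nodes, not necessarily road
     nodes, hence the two side conditions. *)
  road_paths_ends : forall od p, od \in od_pairs -> p \in road_paths od ->
    (od.1 \in road_nodes -> head od.1 p = od.1) /\
    (od.2 \in road_nodes -> last od.2 p = od.2);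
  VOT_gt0 : 0 < VOT;
  background_ge0 : forall e, e \in road_edges -> 0 <= background e;
  road_capacity_gt0 : forall e, e \in road_edges -> 0 < road_capacity e;
  bpr_nondecreasing : forall e, e \in road_edges ->
    {in Num.nneg &, {homo
       bpr (free_flow_time e) (road_capacity e) bpr_alpha bpr_beta
       : q q' / q <= q'}}
}.

Record plan (R : realType) (N L : finType) := Plan {
  xap : N * N -> seq N -> R;
  xa : N * N -> R;
  xpt : N * N -> R;
  flow : N * N -> R;
  rebal : N * N -> R;
  freq : L -> R;
  sel : L -> R -> bool
}.

Section Problems.
Variables (R : realType) (N TE L : finType).
Variable G : network R N TE L.
Implicit Types (y : plan R N L) (pi : N * N -> R) (od e : N * N).

Definition delta (p : seq N) e : bool := e \in zip p (behead p).

Definition travel_time e (q : R) : R :=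
  bpr (free_flow_time G e) (road_capacity G e) (bpr_alpha G) (bpr_beta G) q.

Definition flow_balance y : Prop :=
  forall e, e \in road_edges G ->
    flow y e = rebal y e +
      \sum_(od in od_pairs G) \sum_(p <- road_paths G od)
        xap y od p * (delta p e)%:R.

Definition rebalancing_conservation y : Prop :=
  forall v, v \in road_nodes G ->
    \sum_(e in road_edges G | e.2 == v) rebal y e
      - \sum_(e in road_edges G | e.1 == v) rebal y e
    = \sum_(od in od_pairs G | od.1 == v) \sum_(p <- road_paths G od) xap y od p
      - \sum_(od in od_pairs G | od.2 == v) \sum_(p <- road_paths G od)
          xap y od p.

Definition transit_capacity y : Prop :=
  forall e : TE,
    \sum_(od in od_pairs G) (eta G od e)%:R * xpt y od
    <= \sum_(l : L) line_capacity G l * (mu G l e)%:R * freq y l.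

Definition demand_split y : Prop :=
  forall od, od \in od_pairs G ->
    xa y od = \sum_(p <- road_paths G od) xap y od p /\
    xpt y od = demand G od - xa y od.

(* A genuine quotient only when [xa y od != 0], which holds whenever
   [logit_choice] does. *)
Definition road_time y od : R :=
  \sum_(p <- road_paths G od) xap y od p / xa y od *
    \sum_(e in road_edges G)
      travel_time e (background G e + flow y e) * (delta p e)%:R.

(* Frequencies are not required to be nonzero, and only if [0] is
   admissible can the convention [x / 0 = 0] play a role. *)
Definition transit_time y od : R :=
  tau G od + 2^-1 * \sum_(l : L) (gamma G od l)%:R / freq y l.

Definition road_utility y pi od : R := - VOT G * road_time y od - pi od.

Definition transit_utility y od : R := - VOT G * transit_time y od - fare G.

Definition frequency_selection y : Prop :=
  forall l : L,
    \sum_(s <- frequencies G) (sel y l s)%:R = 1 :> R /\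
    freq y l = \sum_(s <- frequencies G) s * (sel y l s)%:R.

Definition logit_choice y pi : Prop :=
  forall od, od \in od_pairs G ->
    xa y od = demand G od * expR (road_utility y pi od)
      / (expR (road_utility y pi od) + expR (transit_utility y od)).

Definition nonnegativity y : Prop :=
  [/\ forall od p, od \in od_pairs G -> p \in road_paths G od ->
        0 <= xap y od p,
      forall od, od \in od_pairs G -> 0 <= xpt y od &
      forall e, e \in road_edges G -> 0 <= rebal y e].

Definition social_cost y : R :=
  VOT_ENV G * \sum_(e in road_edges G)
      (background G e + flow y e) * travel_time e (background G e + flow y e)
  + VOT G * \sum_(od in od_pairs G) xpt y od * transit_time y od
  + \sum_(e in road_edges G) road_cost G e * flow y e
  + \sum_(l : L) line_cost G l * freq y l.

(* Travel times and utilities are functions of the decision variables, so their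
   defining equations are substituted rather than listed as constraints. *)
Definition original_feasible y pi : Prop :=
  [/\ flow_balance y, rebalancing_conservation y, transit_capacity y & demand_split y] /\
  [/\ frequency_selection y, logit_choice y pi & nonnegativity y].

Definition original_optimal y pi : Prop :=
  original_feasible y pi /\
  forall y' pi', original_feasible y' pi' -> social_cost y <= social_cost y'.

Definition reduced_feasible y : Prop :=
  [/\ flow_balance y, rebalancing_conservation y, transit_capacity y & demand_split y] /\
  [/\ frequency_selection y & nonnegativity y].

Definition reduced_optimal y : Prop :=
  reduced_feasible y /\
  forall y', reduced_feasible y' -> social_cost y <= social_cost y'.

End Problems.

(* Main.v *)
Require Import Defs.
From mathcomp Require Import all_boot all_order all_algebra.
From mathcomp Require Import finmap.
From mathcomp Require Import all_classical all_reals all_analysis.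
From mathcomp Require Import ring.
Import Order.TTheory GRing.Theory Num.Theory.
Local Open Scope ring_scope.

(** The prices occur neither in the social cost nor in any constraint other
    than the logit choice. Forgetting them therefore maps every feasible point
    of the original problem to a feasible point of the reduced one with the
    same cost ([original_reduced_feasible]): the reduced problem is a
    relaxation. A minimizer of a relaxation that can be lifted to the original
    problem is optimal there, so all that is left is to find prices for which
    the reduced optimum satisfies the logit choice. A binary logit model is
    invertible: the shares determine the difference of the two utilities as the
    logarithm of the odds, and conversely ([binary_logit_odds]). Since the road
    utility is affine in the price with slope -1, this difference can be given
    any value, separately for each OD pair, and the recovered price is the one
    that gives it the value [ln (xa / xpt)] ([recovered_utility_gap]). *)

(** Exponentiating the hypothesis gives [expR u = a / b * expR v], so that
    [expR v] cancels from the logit share, which becomes [a / (a + b)]. *)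
Lemma binary_logit_odds (R : realType) (a b u v : R) :
  0 < a -> 0 < b -> u - v = ln (a / b) ->
  a = (a + b) * expR u / (expR u + expR v).
Proof.
move=> a0 b0 gap.
have -> : expR u = a / b * expR v.
  by rewrite -(subrK v u) expRD gap lnK // posrE divr_gt0.
have v0 := expR_gt0 v.
have ab0 := addr_gt0 a0 b0.
field.
rewrite (gt_eqF b0) /=.
have -> : a * expR v + expR v * b = (a + b) * expR v by ring.
by rewrite mulf_neq0 // gt_eqF.
Qed.

Lemma recovered_utility_gap {R : realType} {N TE L : finType}
    (G : network R N TE L) (y : plan R N L) (pi : N * N -> R) (od : N * N) :
  pi od = VOT G * (transit_time G y od - road_time G y od) + fare G
            - ln (xa y od / xpt y od) ->
  road_utility G y pi od - transit_utility G y od = ln (xa y od / xpt y od).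
Proof. by rewrite /road_utility /transit_utility => ->; ring. Qed.

Lemma original_reduced_feasible {R : realType} {N TE L : finType}
    (G : network R N TE L) (y : plan R N L) (pi : N * N -> R) :
  original_feasible G y pi -> reduced_feasible G y.
Proof. by case=> ? [? _ ?]. Qed.

Theorem lemma4p1 (R : realType) (N TE L : finType) (G : network R N TE L)
    (y : plan R N L) (pi : N * N -> R)
    (y_optimal : reduced_optimal G y)
    (prices_defined : forall od : N * N, od \in od_pairs G ->
       0 < xa y od /\ 0 < xpt y od)
    (prices_recovered : forall od : N * N, od \in od_pairs G ->
       pi od = VOT G * (transit_time G y od - road_time G y od) + fare G
               - ln (xa y od / xpt y od)) :
  original_optimal G y pi.
Proof.
case: y_optimal => -[[balance conservation capacity split] [selection nonneg]].
move=> y_min; split; last first.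
  by move=> y' pi' /original_reduced_feasible; exact: y_min.
split=> //; split=> // od od_in.
have [xa_gt0 xpt_gt0] := prices_defined od od_in.
have -> : demand G od = xa y od + xpt y od.
  by have [_ ->] := split od od_in; ring.
apply: binary_logit_odds => //.
exact: recovered_utility_gap (prices_recovered od od_in).
Qed.
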